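(* Let $q\in\mathbb N_1$, $\theta>0$, let $\nu$ be a Borel probability measure on $\Delta^{q-1}$, and let $V_q=\{\mathbf e_1,\dots,\mathbf e_q\}$ be the set of vertices of $\Delta^{q-1}$. Then $\mathscr E^n_{\theta,\nu}[\mathcal M^{(q)}_n]=1$ for all $n\in\mathbb N_1$ if and only if $\nu[V_q]=1$. If so, writing $\nu=\nu_{\boldsymbol\theta}:=\theta^{-1}\sum_{j=1}^q\theta_j\delta_{\mathbf e_j}$ with $\boldsymbol\theta=(\theta_1,\dots,\theta_q)\in[0,\infty)^q\setminus\{\mathbf 0\}$ and $|\boldsymbol\theta|=\theta$, one has $$\mathscr E^n_{\theta,\nu_{\boldsymbol\theta}}=M^{\mathrm{Ewens}}_{\boldsymbol\theta;n}\qquad(n\in\mathbb N_1).$$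
   Context: Notation: $\mathbb N_1=\{1,2,\dots\}$, $\mathbb N_0=\{0,1,\dots\}$, $[q]=\{1,\dots,q\}$, $\mathbb N^q_*=\mathbb N_0^q\setminus\{\mathbf 0\}$, $0^0=1$; $|\mathbf a|=\sum_j|a_j|$, $\mathbf u^{\mathbf a}=\prod_ju_j^{a_j}$, $\binom{|\mathbf a|}{\mathbf a}=|\mathbf a|!/\prod_ja_j!$; $\mathbf e_j$ canonical basis vectors; $\langle\theta\rangle_n=\theta(\theta+1)\cdots(\theta+n-1)$; $\Delta^{q-1}=\{\mathbf u\in[0,1]^q:|\mathbf u|=1\}$; $m_{\mathbf a}(\nu)=\int\mathbf u^{\mathbf a}d\nu(\mathbf u)$. A $q$-chromatic partition of $n$ is a finitely supported map $A\colon\mathbb N^q_*\to\mathbb N_0$ with $\sum_{\mathbf a}A(\mathbf a)|\mathbf a|=n$; $\mathcal A^{(q)}_n$ is the set of these. $\mathcal M^{(q)}_n\subset\mathcal A^{(q)}_n$ is the set of multipartitions: those $A$ such that $A(\mathbf a)>0$ implies $\mathbf a=a\,\mathbf e_j$ for some $a\in[n]$, $j\in[q]$. pESF: $\mathscr E^n_{\theta,\nu}[A]=\frac{n!}{\langle\theta\rangle_n}\prod_{\mathbf a\in\mathrm{supp}A}\frac1{A(\mathbf a)!}\big(\frac{\theta}{|\mathbf a|}\binom{|\mathbf a|}{\mathbf a}m_{\mathbf a}(\nu)\big)^{A(\mathbf a)}$, $A\in\mathcal A^{(q)}_n$. Refined Ewens Sampling Formula with $\boldsymbol\theta\in[0,\infty)^q\setminus\{\mathbf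 0\}$: for $A\in\mathcal M^{(q)}_n$ and $\lambda^{(j)}_a=A(a\,\mathbf e_j)$, $$M^{\mathrm{Ewens}}_{\boldsymbol\theta;n}[A]=\frac{n!}{\langle|\boldsymbol\theta|\rangle_n}\prod_{j=1}^q\prod_{a=1}^n\Big(\frac{\theta_j}a\Big)^{\lambda^{(j)}_a}\frac1{\lambda^{(j)}_a!},$$ regarded as a measure on $\mathcal A^{(q)}_n$ vanishing outside $\mathcal M^{(q)}_n$. *)

(* Defs.v *)
From HB Require Import structures.
From mathcomp Require Import all_boot all_order all_algebra finmap.
From mathcomp Require Import all_classical all_reals all_analysis.
Set Implicit Arguments.
Unset Strict Implicit.
Unset Printing Implicit Defensive.
Import Order.TTheory GRing.Theory Num.Theory.
Import numFieldNormedType.Exports.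
Local Open Scope classical_set_scope.
Local Open Scope ring_scope.

(* In simplex and everything built on it, q.+1 is the number of coordinates:
   measurable types are pointed, which excludes the empty simplex. *)

Definition simplex_set (R : realType) (q : nat) : set 'rV[R]_q :=
  [set u | (forall j, u ord0 j \in `[0, 1]) /\ \sum_(j < q) `|u ord0 j| = 1].

Lemma delta_simplex (R : realType) (q : nat) (j : 'I_q) :
  delta_mx ord0 j \in @simplex_set R q.
Proof.
apply/mem_set; split=> [i|]; first by rewrite mxE in_itv /= ler0n lern1 leq_b1.
rewrite (bigD1 j) //= big1 ?addr0 => [|i /negPf ne_ij].
  by rewrite mxE !eqxx normr1.
by rewrite mxE ne_ij andbF normr0.
Qed.

Definition simplex (R : realType) (q : nat) : Type :=
  set_type (@simplex_set R q.+1).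

Definition vertex (R : realType) (q : nat) (j : 'I_q.+1) : simplex R q :=
  exist _ (delta_mx ord0 j) (delta_simplex R j).

HB.instance Definition _ (R : realType) (q : nat) :=
  Topological.copy (simplex R q) (set_type (@simplex_set R q.+1)).
HB.instance Definition _ (R : realType) (q : nat) :=
  isPointed.Build (simplex R q) (vertex R ord0).

Definition borel_simplex (R : realType) (q : nat) :=
  g_sigma_algebraType (@open (simplex R q)).

Definition vertices (R : realType) (q : nat) : set (borel_simplex R q) :=
  range (@vertex R q).
Arguments vertices R q : clear implicits.

Definition nvec (q : nat) : Type :=
  {a : {ffun 'I_q -> nat} | a != [ffun=> 0%N]}.

Definition ncoord (q : nat) (a : nvec q) (j : 'I_q) : nat :=
  (val a : {ffun _}) j.

Definition nabs (q : nat) (a : nvec q) : nat := (\sum_(j < q) ncoord a j)%N.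

Definition multinom (R : realType) (q : nat) (a : nvec q) : R :=
  (nabs a)`!%:R / \prod_(j < q) (ncoord a j)`!%:R.

Lemma nscale_basis_neq0 (q : nat) (a : nat) (j : 'I_q) :
  [ffun i => if i == j then a.+1 else 0%N] != [ffun=> 0%N].
Proof. by apply/eqP => /ffunP /(_ j); rewrite !ffunE eqxx. Qed.

(* (a + 1) e_j; the shift makes this vector nonzero for every a *)
Definition nbasis (q : nat) (a : nat) (j : 'I_q) : nvec q :=
  exist _ [ffun i => if i == j then a.+1 else 0%N] (nscale_basis_neq0 a j).

Definition weight (q : nat) (A : {fsfun nvec q -> nat with 0%N}) : nat :=
  (\sum_(a <- finsupp A) A a * nabs a)%N.

Definition chromatic_partition (q n : nat) : Type :=
  {A : {fsfun nvec q -> nat with 0%N} | weight A == n}.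

Definition multiplicity (q n : nat) (A : chromatic_partition q n) :
  {fsfun nvec q -> nat with 0%N} := val A.

Definition multipartitions (q n : nat) : set (chromatic_partition q n) :=
  [set A | forall a, (0 < multiplicity A a)%N ->
     exists (k : 'I_n) (j : 'I_q), a = nbasis k j].
Arguments multipartitions q n : clear implicits.

Definition rising (R : realType) (x : R) (n : nat) : R :=
  \prod_(i < n) (x + i%:R).

Definition moment (R : realType) (q : nat)
    (nu : {measure set (borel_simplex R q) -> \bar R}) (a : nvec q.+1) : R :=
  \int[nu]_u \prod_(j < q.+1) (val (u : simplex R q) ord0 j) ^+ ncoord a j.

Definition pESF (R : realType) (q n : nat) (theta : R)
    (nu : {measure set (borel_simplex R q) -> \bar R})
    (A : chromatic_partition q.+1 n) : R :=
  n`!%:R / rising theta n *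
  \prod_(a <- finsupp (multiplicity A))
    (((multiplicity A a)`!%:R)^-1 *
     (theta / (nabs a)%:R * multinom R a * moment nu a) ^+ multiplicity A a).

Definition pESF_measure (R : realType) (q n : nat) (theta : R)
    (nu : {measure set (borel_simplex R q) -> \bar R})
    (S : set (chromatic_partition q.+1 n)) : \bar R :=
  \esum_(A in S) (pESF theta nu A)%:E.

Definition ewens (R : realType) (q n : nat) (thetas : 'I_q -> {nonneg R})
    (A : chromatic_partition q n) : R :=
  if A \in multipartitions q n then
    n`!%:R / rising (\sum_(j < q) (thetas j)%:num) n *
    \prod_(j < q) \prod_(a < n)
      (((thetas j)%:num / a.+1%:R) ^+ multiplicity A (nbasis a j) *
       ((multiplicity A (nbasis a j))`!%:R)^-1)
  else 0.

(* theta^-1 * \sum_j thetas_j * dirac e_j; msum takes a sequence of measures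
   indexed by nat, whence inord *)
Definition nu_thetas (R : realType) (q : nat) (theta : {posnum R})
    (thetas : 'I_q.+1 -> {nonneg R}) :
    {measure set (borel_simplex R q) -> \bar R} :=
  mscale (theta%:num^-1)%:nng
    (msum (fun j : nat => mscale (thetas (inord j))
       (@dirac _ (borel_simplex R q) (vertex R (inord j)) R)) q.+1).

(* Main.v *)
Require Import Defs.
From HB Require Import structures.
From mathcomp Require Import all_boot all_order all_algebra finmap.
From mathcomp Require Import all_classical all_reals all_analysis.
From mathcomp Require Import measurable_realfun ring lra.
Import Order.TTheory GRing.Theory Num.Theory.
Import numFieldNormedType.Exports.
Local Open Scope classical_set_scope.
Local Open Scope ring_scope.

(** Write m(a) for the moment of nu attached to an exponent vector a, and
M_k = \sum_j m(k e_j) = \int \sum_j u_j^k dnu.  A multipartition of n is a family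
of multiplicities f indexed by the pairs (k, j) with 1 <= k <= n, subject to
\sum k f(k, j) = n, and its pESF weight is, up to the factor n! / <theta>_n, the
product of the numbers (theta m(k e_j) / k)^f(k, j) / f(k, j)!.  The mass of the
multipartitions is therefore n! / <theta>_n times the coefficient of X^n in
P = exp(theta \sum_k M_k X^k / k).  Since X P' = theta (\sum_k M_k X^k) P, the
coefficients of P satisfy
  m P_m = theta \sum_(1 <= k <= m) M_k P_(m - k),    P_0 = 1
(pESF_measure_multipartitions, mass_poly_rec).  Polynomials suffice: only the
coefficients up to n matter, so each exponential is truncated and the
differential equation is read modulo X^(n + 1).

If all M_k are 1, the recurrence gives P_m = <theta>_m / m! and every mass is 1.
Conversely M_1 = 1 always holds because the coordinates add up to 1, so the mass
for n = 2 equals (theta + M_2) / (theta + 1), and it is 1 only if M_2 = 1.  Then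
the nonnegative function 1 - \sum_j u_j^2 has integral 0, hence vanishes almost
everywhere, and on the simplex it vanishes only at the vertices (vertices_full).

A probability measure with nu(V) = 1 is the sum of its atoms at the vertices
(vertices_decomposition), so it has the form nu_thetas.  At a vertex e_j the
monomial u^a is 1 if a is a positive multiple of e_j and 0 otherwise; hence the
moments of nu_thetas are theta_j / theta at a = k e_j, for every k, and 0 at the
vectors that are not multiples of a basis vector.  The first fact gives M_k = 1;
both together turn the pESF of nu_thetas into the Ewens formula, a partition that
is not a multipartition having a factor 0 (pESF_nu_thetas). *)

Set Implicit Arguments.
Unset Strict Implicit.
Unset Printing Implicit Defensive.

(** * Exponentials of polynomials, truncated *)

Section ExpPoly.
Variable R : realType.

(** P behaves, up to order N, as an exponential whose exponent has Euler derivative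
G: this is the equation X P' = G P modulo X^(N + 1).  The Euler derivative X d/dX
is preferred to d/dX because it preserves the degree of each monomial. *)
Definition log_deriv_mod (N : nat) (P G : {poly R}) : Prop :=
  dvdp 'X^(N.+1) ('X * P^`() - G * P).

(** Exponents add under multiplication, by the Leibniz rule. *)
Lemma log_deriv_mod_prod N (I : finType) (P G : I -> {poly R}) :
  (forall i, log_deriv_mod N (P i) (G i)) ->
  log_deriv_mod N (\prod_i P i) (\sum_i G i).
Proof.
move=> PG; rewrite /log_deriv_mod.
elim/big_rec2: _ => [|i H Q _]; first by rewrite derivC mulr0 mul0r subr0 dvdp0.
move=> QH; rewrite derivM.
have -> : 'X * ((P i)^`() * Q + P i * Q^`()) - (G i + H) * (P i * Q) =
  ('X * (P i)^`() - G i * P i) * Q + P i * ('X * Q^`() - H * Q) by ring.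
by rewrite dvdp_add //; [apply: dvdp_mulr; exact: PG | exact: dvdp_mull].
Qed.

(** A partial sum of the series exp(c X^s).  Its degree s N may exceed N, which is
harmless modulo X^(N + 1). *)
Definition exp_poly (N s : nat) (c : R) : {poly R} :=
  \sum_(k < N.+1) (c ^+ k / k`!%:R) *: 'X^(s * k).

(** Differentiation shifts the truncated exponential series by one term; the only
discrepancy with s c X^s exp(c X^s) is the last term, of degree s (N + 1) > N. *)
Lemma log_deriv_mod_exp N s c : (0 < s)%N ->
  log_deriv_mod N (exp_poly N s c) ((s%:R * c) *: 'X^s).
Proof.
move=> s_gt0; rewrite /log_deriv_mod /exp_poly.
rewrite raddf_sum /= mulr_sumr big_ord_recl /= expr0 fact0 muln0 expr0.
rewrite derivZ derivC scaler0 mulr0 add0r.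
rewrite big_ord_recr /= mulrDr opprD addrA.
(* what remains is the unmatched top term of G * P; the others cancel in pairs *)
rewrite [X in X - _](_ : _ = 0) ?add0r.
  rewrite dvdpNr -!mul_polyC mulrACA -exprD -mulnS dvdp_mull //.
  by rewrite dvdp_exp2l // leq_pmull.
apply/eqP; rewrite subr_eq0 mulr_sumr; apply/eqP; apply: eq_bigr => k _.
rewrite /bump /= add1n derivZ derivXn.
rewrite -!scalerAr -scalerAl mulrnAr -exprS prednK ?muln_gt0 ?s_gt0 //.
rewrite -[_ *+ (s * _)]scaler_nat !scalerA -exprD -mulnS; congr (_ *: _).
have k_neq0 : k`!%:R != 0 :> R by rewrite pnatr_eq0 -lt0n fact_gt0.
have k1_neq0 : k.+1%:R != 0 :> R by rewrite pnatr_eq0.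
by rewrite factS !natrM exprS; field; rewrite k_neq0 nat1r.
Qed.

(** The coefficients of X^m with m <= N do not see the multiples of X^(N + 1). *)
Lemma log_deriv_mod_coef N P (g : nat -> R) m :
  log_deriv_mod N P (\sum_(a < N) g a *: 'X^(a.+1)) -> (m <= N)%N ->
  m%:R * P`_m = \sum_(a < m) g a * P`_(m - a.+1).
Proof.
move=> /dvdpP [Q eQ] mN.
have /eqP : ('X * P^`() - (\sum_(a < N) g a *: 'X^(a.+1)) * P)`_m = 0.
  by rewrite eQ coefMXn ltnS mN.
rewrite coefB subr_eq0 => /eqP; rewrite coefXM coef_deriv.
have -> : (if m == 0 then 0 else P`_m.-1.+1 *+ m.-1.+1) = m%:R * P`_m.
  by case: m mN => [|m] _ /=; rewrite ?mul0r // mulr_natl.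
move=> ->; rewrite mulr_suml coef_sum (big_ord_widen _ (fun a => g a * P`_(m - a.+1)) mN).
rewrite [RHS]big_mkcond /=; apply: eq_bigr => a _.
by rewrite -scalerAl coefZ mulrC coefXnM ltnS; case: ltnP => am; rewrite ?mulr0 ?mul0r// mulrC.
Qed.

End ExpPoly.

(** * Multipartitions as families of multiplicities *)

(** Each factor contributes one term of its series; choosing f i in the i-th factor
gives a monomial of degree \sum_i f i * s i.  The truncation order also bounds the
choices, which makes them a finite type. *)
Lemma coef_prod_exp_poly (R : realType) N (I : finType) (s : I -> nat) (c : I -> R) m :
  (\prod_i exp_poly N (s i) (c i))`_m =
  \sum_(f : {ffun I -> 'I_N.+1} | (\sum_i f i * s i == m)%N)
     \prod_i (c i ^+ f i / (f i)`!%:R).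
Proof.
rewrite (bigA_distr_bigA (fun i (k : 'I_N.+1) => (c i ^+ k / k`!%:R) *: 'X^(s i * k))).
rewrite coef_sum [RHS]big_mkcond; apply: eq_bigr => f _ /=.
rewrite scaler_prod -(big_morph (fun k => 'X^k) (exprD 'X) (expr0 'X)) coefZ coefXn.
rewrite (eq_bigr (fun i => f i * s i)%N) => [|i _]; last by rewrite mulnC.
by rewrite eq_sym; case: eqP => _; rewrite ?mulr1 ?mulr0.
Qed.

Section Multipartitions.
Variables (q n : nat).

(** The pair (k, j) stands for the part (k + 1) e_j, as in nbasis. *)
Definition part : finType := ('I_n * 'I_q)%type.
Definition part_vec (i : part) : nvec q := nbasis i.1 i.2.

Lemma nabs_nbasis (a : nat) (j : 'I_q) : nabs (nbasis a j) = a.+1.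
Proof.
rewrite /nabs (bigD1 j) //= big1 => [|i /negPf ij].
  by rewrite /ncoord /= ffunE eqxx addn0.
by rewrite /ncoord /= ffunE ij.
Qed.

Lemma nabs_leq (A : chromatic_partition q n) a :
  (0 < multiplicity A a)%N -> (nabs a <= n)%N.
Proof.
move=> Aa; have /eqP wA := valP A.
rewrite -[leqRHS]wA /weight (big_fsetD1 a) /=; last by rewrite mem_finsupp -lt0n.
by rewrite (leq_trans _ (leq_addr _ _)) // leq_pmull.
Qed.

Lemma part_vec_inj : injective part_vec.
Proof.
move=> [k j] [k' j'] e; rewrite /part_vec /= in e.
have ek : (k : nat) = k' by apply: succn_inj; rewrite -(nabs_nbasis k j) e nabs_nbasis.
have /ffunP /(_ j) : val (nbasis k j) = val (nbasis k' j') by rewrite e.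
rewrite !ffunE eqxx; case: eqP => // <- _.
by congr pair; apply: val_inj.
Qed.

(** The support of a multipartition lies among the parts, and the parts outside the
support contribute the neutral element.  This is used both for the weight and for
the pESF product. *)
Lemma big_multipartition (T : Type) (idx : T) (op : Monoid.com_law idx)
    (A : chromatic_partition q n) (F : nvec q -> nat -> T) :
  multipartitions q n A -> (forall a, F a 0%N = idx) ->
  \big[op/idx]_(a <- finsupp (multiplicity A)) F a (multiplicity A a) =
  \big[op/idx]_(i : part) F (part_vec i) (multiplicity A (part_vec i)).
Proof.
move=> MA F0.
rewrite (@big_fset_incl _ _ _ _ _ [fset part_vec i | i in part]%fset).
- by rewrite big_imfset /= ?big_enum // => i j _ _; exact: part_vec_inj.
- apply/fsubsetP => a; rewrite mem_finsupp -lt0n => /MA [k [j ->]].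
  by apply/imfsetP; exists (k, j).
- by move=> a _; rewrite memNfinsupp => /eqP ->.
Qed.

Definition part_counts (A : chromatic_partition q n) : {ffun part -> 'I_n.+1} :=
  [ffun i => inord (multiplicity A (part_vec i))].

(** No multiplicity exceeds n because every part has size at least 1, so reading
the multiplicities in 'I_n.+1 loses nothing. *)
Lemma part_countsE A i : multipartitions q n A ->
  part_counts A i = multiplicity A (part_vec i) :> nat.
Proof.
move=> MA; rewrite ffunE inordK // ltnS.
have /eqP := valP A; rewrite /weight.
rewrite (@big_multipartition _ _ _ _ (fun a k => k * nabs a)%N MA) // => wA.
rewrite -[leqRHS]wA (bigD1 i) //= nabs_nbasis.
by rewrite (leq_trans _ (leq_addr _ _)) // leq_pmulr.
Qed.

Lemma weight_part_counts A : multipartitions q n A ->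
  (\sum_i part_counts A i * i.1.+1 == n)%N.
Proof.
move=> MA; have := valP A; rewrite /weight.
rewrite (@big_multipartition _ _ _ _ (fun a k => k * nabs a)%N MA) //.
by under eq_bigr => i _ do rewrite -part_countsE // nabs_nbasis.
Qed.

Lemma part_counts_bij :
  set_bij (multipartitions q n)
    [set f : {ffun part -> 'I_n.+1} | (\sum_i f i * i.1.+1 == n)%N] part_counts.
Proof.
split=> [A|A B|f /= fn].
- exact: weight_part_counts.
- rewrite !inE => MA MB eAB; apply: val_inj; apply/fsfunP => a.
  have E (i : part) : multiplicity A (part_vec i) = multiplicity B (part_vec i).
    by rewrite -!part_countsE // eAB.
  have [A0|/MA [k [j ->]]] := posnP (multiplicity A a); last exact: (E (k, j)).
  have [B0|/MB [k [j ->]]] := posnP (multiplicity B a); last exact: (E (k, j)).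
  by rewrite [LHS]A0 [RHS]B0.
(* preimage of f: the partition with support in D, where the part of index i
   has multiplicity f i *)
pose D := [fset part_vec i | i in part]%fset.
pose h a := if [pick i | part_vec i == a] is Some i then f i : nat else 0%N.
have hE i : h (part_vec i) = f i.
  rewrite /h; case: pickP => [i' /eqP /part_vec_inj -> //|/(_ i)].
  by rewrite eqxx.
pose A := [fsfun a in D => h a | 0%N].
have AE i : A (part_vec i) = f i.
  by rewrite fsfunE hE in_imfset.
have AP a : (0 < A a)%N -> exists k j, a = nbasis (k : 'I_n) (j : 'I_q).
  rewrite fsfunE; case: ifP => // /imfsetP [[k j] _ ->] _.
  by exists k, j.
have wA : weight A == n.
  rewrite /weight (big_fset_incl _ (B := D)) /=; first last.
  - by move=> a _; rewrite memNfinsupp => /eqP ->.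
  - exact: finsupp_sub.
  rewrite big_imfset /= ?big_enum //; last by move=> i j _ _; exact: part_vec_inj.
  by rewrite -[X in _ == X](eqP fn); apply/eqP/eq_bigr => i _; rewrite AE nabs_nbasis.
have MA : multipartitions q n (exist _ A wA) by [].
exists (exist _ A wA) => //.
apply/ffunP => i; apply/val_inj; rewrite /= part_countsE //; exact: AE.
Qed.

(** Multiplicative weights are summed over a finite type of multiplicities instead
of a set of finitely supported maps. *)
Lemma esum_multipartitions (R : realType) (F : nvec q -> nat -> R) (C : R) :
  0 <= C -> (forall a k, 0 <= F a k) -> (forall a, F a 0%N = 1) ->
  \esum_(A in multipartitions q n)
    (C * \prod_(a <- finsupp (multiplicity A)) F a (multiplicity A a))%:E =
  (C * \sum_(f : {ffun part -> 'I_n.+1} | (\sum_i f i * i.1.+1 == n)%N)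
     \prod_i F (part_vec i) (f i))%:E.
Proof.
move=> C0 F0 F1.
pose w (f : {ffun part -> 'I_n.+1}) := (C * \prod_i F (part_vec i) (f i))%:E.
transitivity (\esum_(A in multipartitions q n) w (part_counts A)).
  apply: eq_esum => A MA; rewrite /w; congr (_ * _)%:E.
  rewrite (big_multipartition _ MA) //.
  by apply: eq_bigr => i _; rewrite part_countsE.
rewrite -(reindex_esum _ _ _ w part_counts_bij) esum_fset; first last.
- by move=> f _; rewrite lee_fin mulr_ge0 // prodr_ge0.
- exact: finite_finset.
rewrite fsbig_finite; last exact: finite_finset.
rewrite mulr_sumr -sumEFin.
rewrite -[RHS]big_filter; apply: perm_big; apply: uniq_perm.
- exact: fset_uniq.
- by rewrite filter_uniq // index_enum_uniq.
- move=> f; rewrite mem_filter mem_index_enum andbT in_fset_set ?inE //.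
    by apply/idP/idP; rewrite inE.
  exact: finite_finset.
Qed.

End Multipartitions.

(** * The mass of the multipartitions *)

Section Mass.
Variables (R : realType) (q : nat) (theta : R).
Variable nu : {measure set (borel_simplex R q) -> \bar R}.
Hypothesis theta_gt0 : 0 < theta.

Lemma multinom_nbasis a (j : 'I_q.+1) : multinom R (nbasis a j) = 1.
Proof.
rewrite /multinom nabs_nbasis (bigD1 j) //= big1 => [|i /negPf ij].
  by rewrite /ncoord /= ffunE eqxx mulr1 divff // pnatr_eq0 -lt0n fact_gt0.
by rewrite /ncoord /= ffunE ij.
Qed.

Lemma moment_ge0 a : 0 <= moment nu a.
Proof.
apply: Rintegral_ge0 => u _; apply: prodr_ge0 => j _; apply: exprn_ge0.
by have /set_mem [/(_ j) + _] := valP (u : simplex R q); rewrite in_itv => /andP[].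
Qed.

Lemma rising_gt0 n : 0 < rising theta n.
Proof. by apply: prodr_gt0 => i _; rewrite ltr_wpDr. Qed.

(** This is M_(a + 1), the integral of the sum of the (a + 1)-st powers of the
coordinates. *)
Definition vertex_moment a : R := \sum_(j < q.+1) moment nu (nbasis a j).

(** Agrees up to X^n with exp(theta \sum_k M_k X^k / k), factored over the parts. *)
Definition mass_poly n : {poly R} :=
  \prod_(i : part q.+1 n)
    exp_poly n i.1.+1 (theta / i.1.+1%:R * moment nu (part_vec i)).

Lemma pESF_measure_multipartitions n :
  pESF_measure theta nu (multipartitions q.+1 n) =
  (n`!%:R / rising theta n * (mass_poly n)`_n)%:E.
Proof.
rewrite /pESF_measure /pESF (@esum_multipartitions q.+1 n R
  (fun a k => k`!%:R^-1 * (theta / (nabs a)%:R * multinom R a * moment nu a) ^+ k)).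
- rewrite /mass_poly coef_prod_exp_poly; congr (_ * _)%:E.
  apply: eq_bigr => f _; apply: eq_bigr => i _.
  by rewrite nabs_nbasis multinom_nbasis mulr1 mulrC.
- by rewrite divr_ge0 // ltW // rising_gt0.
- move=> a k; rewrite mulr_ge0 ?invr_ge0 // exprn_ge0 // !mulr_ge0 ?moment_ge0 ?invr_ge0 //.
    exact: ltW.
  by rewrite prodr_ge0.
- by move=> a; rewrite fact0 invr1 mul1r expr0.
Qed.

Lemma mass_poly0 n : (mass_poly n)`_0 = 1.
Proof.
rewrite -horner_coef0 horner_prod big1 // => i _.
rewrite /exp_poly horner_sum big_ord_recl big1 => [|k _].
  by rewrite muln0 !expr0 fact0 invr1 mulr1 scale1r hornerC addr0.
by rewrite hornerZ hornerXn /bump /= mulnS expr0n /= mulr0.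
Qed.

(** A part of size k has exponent theta m(k e_j) X^k / k, whose Euler derivative is
theta m(k e_j) X^k: the factor 1 / k disappears, and summing over j leaves
theta M_k X^k. *)
Lemma mass_poly_rec n m : (m <= n)%N ->
  m%:R * (mass_poly n)`_m =
  \sum_(a < m) theta * vertex_moment a * (mass_poly n)`_(m - a.+1).
Proof.
apply: (log_deriv_mod_coef (g := fun a => theta * vertex_moment a)).
have := log_deriv_mod_prod (fun i : part q.+1 n => log_deriv_mod_exp n
  (theta / i.1.+1%:R * moment nu (part_vec i)) (ltn0Sn i.1)).
congr log_deriv_mod.
rewrite -(pair_bigA _ (fun (k : 'I_n) (j : 'I_q.+1) =>
  (k.+1%:R * (theta / k.+1%:R * moment nu (nbasis k j))) *: 'X^(k.+1))) /=.
apply: eq_bigr => k _; rewrite -scaler_suml mulr_sumr; congr (_ *: _).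
apply: eq_bigr => j _.
by rewrite mulrA mulrCA divff ?mulr1 // pnatr_eq0.
Qed.

(** When all M_k are 1, P is (1 - X)^(- theta) up to order n: all the terms of
the recurrence at m + 1 but the first add up to m P_m, by the recurrence at m, so
that (m + 1) P_(m + 1) = (theta + m) P_m. *)
Lemma mass_poly_coef n m : (forall a, vertex_moment a = 1) -> (m <= n)%N ->
  (mass_poly n)`_m = rising theta m / m`!%:R.
Proof.
move=> M1; elim: m => [_|m IH mn].
  by rewrite mass_poly0 /rising big_ord0 fact0 divr1.
have m1_neq0 : m.+1%:R != 0 :> R by rewrite pnatr_eq0.
have mf_neq0 : m`!%:R != 0 :> R by rewrite pnatr_eq0 -lt0n fact_gt0.
apply: (mulfI m1_neq0); rewrite mass_poly_rec // big_ord_recl subn1 M1 mulr1 /=.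
have -> : \sum_(a < m) theta * vertex_moment (bump 0 a) *
    (mass_poly n)`_(m.+1 - (bump 0 a).+1) = m%:R * (mass_poly n)`_m.
  rewrite mass_poly_rec 1?ltnW //; apply: eq_bigr => a _.
  by rewrite !M1 /bump add1n subSS.
rewrite (IH (ltnW mn)) /rising big_ord_recr /= factS natrM.
by field; rewrite nat1r m1_neq0 mf_neq0.
Qed.

Lemma pESF_measure_multipartitions_eq1 n : (forall a, vertex_moment a = 1) ->
  pESF_measure theta nu (multipartitions q.+1 n) = 1%E.
Proof.
move=> M1; rewrite pESF_measure_multipartitions mass_poly_coef //.
congr EFin; field.
by rewrite (gt_eqF (rising_gt0 n)) pnatr_eq0 -lt0n fact_gt0.
Qed.

(** The case n = 2 alone decides: there the mass is (theta + M_2) / (theta + 1). *)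
Lemma vertex_moment1_of_mass2 : vertex_moment 0 = 1 ->
  pESF_measure theta nu (multipartitions q.+1 2) = 1%E -> vertex_moment 1 = 1.
Proof.
move=> M0; rewrite pESF_measure_multipartitions => -[].
have /= := mass_poly_rec (leqnn 2); have /= := @mass_poly_rec 2 1 isT.
rewrite !big_ord_recr !big_ord0 /= !add0r M0 subnn mass_poly0 mul1r !mulr1 => -> E.
rewrite /rising !big_ord_recr big_ord0 /= !factS fact0 => E2.
have t0 : theta != 0 by rewrite gt_eqF.
have t1 : theta + 1 != 0 by rewrite gt_eqF // ltr_wpDr.
have {}E2 : 2 * (mass_poly 2)`_2 = theta * (theta + 1).
  have : theta * (theta + 1) != 0 by rewrite mulf_neq0.
  move: E2; rewrite !muln1 mul1r addr0 => + tt.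
  by move=> /(congr1 (fun x => x * (theta * (theta + 1)))); rewrite mul1r mulrAC divfK.
apply: (mulfI t0).
by move: E; rewrite E2 => E; lra.
Qed.

End Mass.

(** * Integration over the simplex *)

Section SimplexMeasure.
Variables (R : realType) (q : nat).
Local Notation X := (borel_simplex R q).

Definition coord (j : 'I_q.+1) (u : X) : R := val (u : simplex R q) ord0 j.

Definition monomial (a : nvec q.+1) (u : X) : R :=
  \prod_j coord j u ^+ ncoord a j.

Lemma coord_ge0 j u : 0 <= coord j u.
Proof.
have /set_mem [/(_ j) + _] := valP (u : simplex R q).
by rewrite in_itv => /andP[].
Qed.

Lemma coord_le1 j u : coord j u <= 1.
Proof.
have /set_mem [/(_ j) + _] := valP (u : simplex R q).
by rewrite in_itv => /andP[].
Qed.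

Lemma sum_coord u : \sum_j coord j u = 1.
Proof.
have /set_mem [_ <-] := valP (u : simplex R q).
by apply: eq_bigr => j _; rewrite [RHS]ger0_norm // (coord_ge0 j u).
Qed.

Lemma coord_vertex i j : coord i (vertex R j) = (i == j)%:R.
Proof. by rewrite /coord /= mxE eqxx. Qed.

(** The coordinates are nonnegative with sum 1, so a coordinate equal to 1 leaves
nothing for the others. *)
Lemma coord_eq1 j u : coord j u = 1 -> u = vertex R j.
Proof.
move=> uj; apply: val_inj; apply/rowP => i; rewrite -[LHS]/(coord i u).
rewrite -[RHS]/(coord i (vertex R j)) coord_vertex.
have [->//|ij] := eqVneq i j.
have /eqP := sum_coord u; rewrite (bigD1 j) //= uj -subr_eq0 addrAC subrr add0r.
rewrite psumr_eq0 => [/allP /(_ i)|k _]; last exact: coord_ge0.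
by rewrite mem_index_enum ij => /(_ isT) /eqP.
Qed.

(** Coordinates are continuous for the subspace topology, whose open sets generate
the sigma-algebra. *)
Lemma measurable_coord j : measurable_fun setT (coord j).
Proof.
apply: (measurability _ (RGenOpens.measurableE R)).
move=> _ [_ [a [b ->] <-]]; rewrite setTI; apply: sub_sigma_algebra.
have cj : continuous (fun u : simplex R q => val u ord0 j).
  move=> u; apply: (@continuous_comp _ _ _ (val : simplex R q -> 'rV[R]_q.+1) (fun M => M ord0 j)).
    exact: initial_continuous.
  exact: coord_continuous.
by move/continuousP : cj; apply; exact: interval_open.
Qed.

Lemma vertexE j : [set (vertex R j : X)] = coord j @^-1` [set 1].
Proof.
apply/seteqP; split=> [u ->|u /coord_eq1] //=.
by rewrite coord_vertex eqxx.
Qed.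

Lemma measurable_vertex j : measurable [set (vertex R j : X)].
Proof. by rewrite vertexE -[X in measurable X]setTI; exact: measurable_coord. Qed.

Lemma vertex_inj : injective (fun j => vertex R j : X).
Proof.
move=> i j ij; have := coord_vertex i j; rewrite -ij coord_vertex eqxx.
by case: eqP => // _ /eqP; rewrite oner_eq0.
Qed.

Lemma verticesE : vertices R q = \bigcup_(j in [set: 'I_q.+1]) [set (vertex R j : X)].
Proof. by apply/seteqP; split=> [u [j _ <-]|u [j _ ->]]; exists j. Qed.

Lemma measurable_vertices : measurable (vertices R q).
Proof.
rewrite verticesE; apply: fin_bigcup_measurable => // j _.
exact: measurable_vertex.
Qed.

Lemma measurable_verticesC : measurable (~` vertices R q).
Proof. by apply: measurableC; exact: measurable_vertices. Qed.

(** The difference of \sum_j u_j and \sum_j u_j^2 is the sum of the nonnegative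
numbers u_j (1 - u_j), so each u_j is 0 or 1, and some u_j is 1 because
the sum is not 0. *)
Lemma vertices_sum_sqr u : \sum_j coord j u ^+ 2 = 1 -> vertices R q u.
Proof.
move=> /eqP; rewrite -[X in _ == X](sum_coord u) eq_sym -subr_eq0 -sumrB.
have h j : coord j u - coord j u ^+ 2 = coord j u * (1 - coord j u) by ring.
rewrite (eq_bigr _ (fun j _ => h j)) psumr_eq0 => [/allP u01|j _]; last first.
  by rewrite mulr_ge0 ?coord_ge0 // subr_ge0 coord_le1.
have [j uj] : exists j, coord j u != 0.
  apply/existsP; apply: contra_eqT (sum_coord u) => /existsPn u0.
  rewrite big1 1?eq_sym ?oner_eq0 // => j _.
  by apply/eqP; have := u0 j; rewrite negbK.
exists j => //; apply/esym/coord_eq1.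
have := u01 j (mem_index_enum j).
by rewrite mulf_eq0 (negPf uj) subr_eq0 /= => /eqP.
Qed.

(** A monomial is 1 at e_j if its exponent vector is a multiple of e_j and 0
otherwise.  The multiple can only be the one given by the j-th exponent, whose
predecessor compensates the shift in nbasis. *)
Lemma vertex_monomial (a : nvec q.+1) j :
  monomial a (vertex R j) = (a == nbasis (ncoord a j).-1 j)%:R.
Proof.
rewrite /monomial.
have [[i /andP[ij ai]]|] := pselect (exists i, (i != j) && (ncoord a i != 0)%N).
  rewrite (bigD1 i) //= coord_vertex (negPf ij) expr0n (negPf ai) mul0r.
  case: eqP => // e; move: ai; rewrite e {1}/ncoord /= ffunE (negPf ij).
  by rewrite eqxx.
move=> /forallNP a0.
have {}a0 i : i != j -> ncoord a i = 0%N.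
  by move=> ij; apply/eqP/negPn/negP => ai; apply: (a0 i); rewrite ij.
rewrite (bigD1 j) //= coord_vertex eqxx expr1n big1 => [|i /a0 -> //].
have aj : (0 < ncoord a j)%N.
  rewrite lt0n; apply: contra (valP a) => /eqP aj.
  apply/eqP/ffunP => i; rewrite ffunE; have [->|/a0] := eqVneq i j; first exact: aj.
  by [].
suff -> : a = nbasis (ncoord a j).-1 j by rewrite mulr1 {2}/ncoord /= ffunE !eqxx.
apply/val_inj/ffunP => i; rewrite ffunE prednK //.
by case: eqP => [->//|/eqP /a0].
Qed.

Lemma nbasis_monomial a j u : monomial (nbasis a j) u = coord j u ^+ a.+1.
Proof.
rewrite /monomial (bigD1 j) //= big1 => [|i /negPf ij].
  by rewrite mulr1 /ncoord /= ffunE eqxx.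
by rewrite /ncoord /= ffunE ij.
Qed.

Lemma monomial_ge0 a u : 0 <= monomial a u.
Proof. by apply: prodr_ge0 => j _; apply: exprn_ge0; exact: coord_ge0. Qed.

Lemma measurable_monomial a : measurable_fun setT (monomial a).
Proof.
apply: measurable_prod => j _; apply: measurable_funX; exact: measurable_coord.
Qed.

Lemma sum_coord_expS a u : \sum_j coord j u ^+ a.+1 <= 1.
Proof.
rewrite -[leRHS](sum_coord u); apply: ler_sum => j _.
by rewrite exprS ler_piMr ?coord_ge0 // exprn_ile1 ?coord_ge0 ?coord_le1.
Qed.

Section Probability.
Variable nu : probability X R.

(** Monomials take values in [0, 1], so the extended-real integral is finite and its
real part loses nothing. *)
Lemma moment_EFin a : (moment nu a)%:E = (\int[nu]_u (monomial a u)%:E)%E.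
Proof.
rewrite /moment /Rintegral fineK //.
apply: (integrable_fin_num measurableT).
apply: (measurable_bounded_integrable measurableT).
- by apply: le_lt_trans (ltry 1); rewrite -(probability_setT nu).
- exact: measurable_monomial.
- exists 1; split; first exact: num_real.
  move=> M M1 u _ /=; rewrite ger0_norm ?monomial_ge0 //.
  apply: le_trans (ltW M1); apply: prodr_ile1 => j.
  by rewrite exprn_ge0 ?coord_ge0 // exprn_ile1 ?coord_ge0 ?coord_le1.
Qed.

Lemma vertex_moment_EFin a :
  (vertex_moment nu a)%:E = (\int[nu]_u (\sum_j coord j u ^+ a.+1)%:E)%E.
Proof.
rewrite /vertex_moment -sumEFin.
under [RHS]eq_integral do rewrite -sumEFin.
rewrite ge0_integral_sum //.
- apply: eq_bigr => j _; rewrite moment_EFin; apply: eq_integral => u _.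
  by rewrite nbasis_monomial.
- move=> j; apply/measurable_EFinP; apply: measurable_funX; exact: measurable_coord.
- by move=> j u _; rewrite lee_fin exprn_ge0 ?coord_ge0.
Qed.

Lemma integral_one : (\int[nu]_u 1%:E = 1)%E.
Proof. by rewrite integral_cst // mul1e; exact: probability_setT. Qed.

Lemma vertex_moment0 : vertex_moment nu 0 = 1.
Proof.
apply: EFin_inj; rewrite vertex_moment_EFin.
under eq_integral do (under eq_bigr do rewrite expr1; rewrite sum_coord).
exact: integral_one.
Qed.

(** 1 - \sum_j u_j^2 is nonnegative on the simplex and has integral 1 - M_2. *)
Lemma vertices_full : vertex_moment nu 1 = 1 -> nu (vertices R q) = 1%E.
Proof.
move=> M1; pose g u := 1 - \sum_j coord j u ^+ 2.
have mS : measurable_fun setT (fun u => \sum_j coord j u ^+ 2).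
  by apply: measurable_sum => j; apply: measurable_funX; exact: measurable_coord.
have mg : measurable_fun setT g by apply: measurable_funB.
have g0 u : 0 <= g u by rewrite subr_ge0 sum_coord_expS.
have Ig : (\int[nu]_u (g u)%:E = 0)%E.
  have : (\int[nu]_u (cst 1 u)%:E = \int[nu]_u ((\sum_j coord j u ^+ 2)%:E + (g u)%:E))%E.
    by apply: eq_integral => u _; rewrite -EFinD /g addrC subrK.
  rewrite ge0_integralD //; first last.
  - exact/measurable_EFinP.
  - by move=> u _; rewrite lee_fin.
  - exact/measurable_EFinP.
  - by move=> u _; rewrite lee_fin sumr_ge0 // => j _; rewrite exprn_ge0 ?coord_ge0.
  rewrite -vertex_moment_EFin M1 integral_one.
  case: (\int[nu]_u (g u)%:E)%E => // r [] r0.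
  by congr EFin; lra.
have : ae_eq nu setT (fun u => (g u)%:E) (cst 0%E).
  apply/ae_eq_integral_abs => //; first exact/measurable_EFinP.
  by rewrite -[RHS]Ig; apply: eq_integral => u _; rewrite gee0_abs // lee_fin.
move=> [Z [mZ nuZ subZ]].
have nuC : nu (~` vertices R q) = 0%E.
  apply: (subset_measure0 _ mZ _ nuZ); first exact: measurable_verticesC.
  move=> u uV; apply: subZ => /= /(_ I) [] /eqP.
  rewrite subr_eq0 eq_sym => /eqP /vertices_sum_sqr; exact: uV.
by rewrite -[vertices R q]setCK probability_setC ?nuC ?sube0 //; exact: measurable_verticesC.
Qed.

(** A measure carried by a finite set of measurable points is the combination of
the Dirac masses at these points; theta_j is theta times the mass of e_j. *)
Lemma vertices_decomposition (theta : {posnum R}) : nu (vertices R q) = 1%E ->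
  exists thetas : 'I_q.+1 -> {nonneg R},
    [/\ exists j, (thetas j)%:num != 0,
        \sum_(j < q.+1) (thetas j)%:num = theta%:num
      & forall S : set X, measurable S -> nu S = nu_thetas theta thetas S].
Proof.
move=> nuV.
have finV j : nu [set (vertex R j : X)] \is a fin_num.
  by apply: fin_num_measure; exact: measurable_vertex.
have sumV (S : set X) : measurable S ->
    nu S = (\sum_j nu [set (vertex R j : X)] * \d_(vertex R j : X) S)%E.
  move=> mS.
  have -> : nu S = nu (S `&` vertices R q).
    rewrite -[in LHS](setIT S) -(setUv (vertices R q)) setIUr measureU.
    - rewrite [X in (_ + X)%E](_ : _ = 0%E) ?adde0 //.
      apply: (@subset_measure0 _ _ _ _ _ (~` vertices R q)) => //.
      + by apply: measurableI => //; exact: measurable_verticesC.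
      + exact: measurable_verticesC.
      + by have := probability_setC nu measurable_vertices; rewrite nuV subee.
    - by apply: measurableI => //; exact: measurable_vertices.
    - by apply: measurableI => //; exact: measurable_verticesC.
    - by rewrite setIACA setICr setI0.
  rewrite verticesE setI_bigcupr measure_fin_bigcup; first last.
  - by move=> j _; apply: measurableI => //; exact: measurable_vertex.
  - by move=> i j _ _ [u [[_ ->] [_]]] /vertex_inj.
  - exact: finite_finset.
  have -> : [set: 'I_q.+1] = [set` index_enum 'I_q.+1].
    by apply/seteqP; split=> // j _ /=; exact: mem_index_enum.
  rewrite -fsbig_seq ?index_enum_uniq //; apply: eq_bigr => j _.
  by rewrite setI1 diracE; case: ifP => _; rewrite ?mule1 // mule0 measure0.
have pV_ge0 j : 0 <= theta%:num * fine (nu [set (vertex R j : X)]).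
  by rewrite mulr_ge0 // fine_ge0.
pose thetas j := NngNum (pV_ge0 j).
have sumT : \sum_(j < q.+1) (thetas j)%:num = theta%:num.
  rewrite -mulr_sumr -[RHS]mulr1; congr (_ * _).
  apply: EFin_inj; rewrite -nuV (sumV _ measurable_vertices) -sumEFin.
  apply: eq_bigr => j _; rewrite fineK // diracE mem_set ?mule1 //.
  by exists j.
exists thetas; split => //.
- apply/existsP; apply: contra_eqT sumT => /existsPn t0.
  rewrite big1 => [|j _]; first by rewrite eq_sym gt_eqF.
  by apply/eqP; have := t0 j; rewrite negbK.
- move=> S mS; rewrite sumV // /nu_thetas /= /mscale /msum /=.
  rewrite ge0_sume_distrr => [|j _]; last by rewrite mule_ge0.
  apply: eq_bigr => j _; rewrite inord_val /mscale /= !muleA; congr (_ * _)%E.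
  by rewrite -EFinM mulrA mulVf // mul1r fineK.
Qed.

End Probability.

End SimplexMeasure.

(** * Measures carried by the vertices *)

Section VertexMeasure.
Variables (R : realType) (q : nat) (theta : {posnum R}).
Variable thetas : 'I_q.+1 -> {nonneg R}.

Lemma moment_nu_thetas (a : nvec q.+1) :
  moment (nu_thetas theta thetas) a =
  theta%:num^-1 *
  \sum_j (thetas j)%:num * (a == nbasis (ncoord a j).-1 j)%:R.
Proof.
have ma := (measurable_EFinP _ _).2 (@measurable_monomial R q a).
have a0 u : [set: borel_simplex R q] u ->
    (0 <= (EFin \o monomial a) u)%E.
  by rewrite lee_fin monomial_ge0.
rewrite /moment /Rintegral -[RHS]/(fine (_%:E)); congr fine.
rewrite (ge0_integral_mscale _ measurableT _ ma a0) EFinM -sumEFin; congr (_ * _)%E.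
rewrite (ge0_integral_measure_sum _ measurableT a0 ma).
apply: eq_bigr => j _; rewrite inord_val.
rewrite (ge0_integral_mscale _ measurableT _ ma a0) integral_dirac //.
by rewrite diracT mul1e /= vertex_monomial EFinM.
Qed.

Lemma nbasis_eq_vertex k (l j : 'I_q.+1) :
  (nbasis k l == nbasis (ncoord (nbasis k l) j).-1 j) = (j == l).
Proof.
rewrite /ncoord /= ffunE; have [->|jl] := eqVneq j l; first by rewrite eqxx.
apply/eqP => /(congr1 (fun a : nvec _ => ncoord a j)).
by rewrite /ncoord /= !ffunE (negPf jl) eqxx.
Qed.

Lemma moment_nu_thetas_nbasis k l :
  moment (nu_thetas theta thetas) (nbasis k l) = (thetas l)%:num / theta%:num.
Proof.
rewrite moment_nu_thetas (bigD1 l) //= nbasis_eq_vertex eqxx mulr1.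
by rewrite big1 ?addr0 1?mulrC // => j /negPf jl; rewrite nbasis_eq_vertex jl mulr0.
Qed.

(** A part that is not a multiple of a basis vector has moment 0.  Multiples of size
larger than n are the other way to leave the multipartitions, but a partition of n
has no part of that size. *)
Lemma moment_nu_thetas_eq0 n (A : chromatic_partition q.+1 n) :
  ~ multipartitions q.+1 n A ->
  exists2 a, (0 < multiplicity A a)%N & moment (nu_thetas theta thetas) a = 0.
Proof.
move=> /existsNP [a /not_implyP [Aa nb]]; exists a => //.
rewrite moment_nu_thetas big1 ?mulr0 // => j _; case: eqP => [aE|_]; last by rewrite mulr0.
have := nabs_leq Aa; rewrite {1}aE nabs_nbasis => kn.
by case: nb; exists (Ordinal kn), j.
Qed.

Lemma pESF_nu_thetas : \sum_(j < q.+1) (thetas j)%:num = theta%:num ->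
  forall n (A : chromatic_partition q.+1 n),
  pESF theta%:num (nu_thetas theta thetas) A = ewens thetas A.
Proof.
move=> sumT n A; rewrite /pESF /ewens sumT; case: ifPn => [/set_mem MA|nMA].
  congr (_ * _).
  rewrite (big_multipartition _ (F := fun a k => k`!%:R^-1 *
    (theta%:num / (nabs a)%:R * multinom R a * moment (nu_thetas theta thetas) a) ^+ k) MA);
    last by move=> a; rewrite fact0 invr1 mul1r expr0.
  rewrite exchange_big pair_bigA /=; apply: eq_bigr => -[k j] _ /=.
  rewrite nabs_nbasis multinom_nbasis mulr1 moment_nu_thetas_nbasis mulrC.
  congr (_ ^+ _ * _); field.
  by rewrite nat1r pnatr_eq0 /=.
have [a Aa ma] : exists2 a, (0 < multiplicity A a)%N &
    moment (nu_thetas theta thetas) a = 0.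
  by apply: moment_nu_thetas_eq0 => MA; rewrite (mem_set MA) in nMA.
rewrite (big_fsetD1 a) /=; last by rewrite mem_finsupp -lt0n.
by rewrite ma mulr0 expr0n eqn0Ngt Aa mulr0 mul0r mulr0.
Qed.

End VertexMeasure.

(** A power sum of the coordinates is 1 at each vertex.  The parameter theta is only
a normalisation of the weights here, and is taken to be 1. *)
Lemma vertex_moment_eq1 (R : realType) q (nu : probability (borel_simplex R q) R) :
  nu (vertices R q) = 1%E -> forall a, vertex_moment nu a = 1.
Proof.
move=> /(vertices_decomposition 1%:pos) [thetas [_ sumT nuE]] a.
rewrite /vertex_moment -[RHS]sumT; apply: eq_bigr => j _.
transitivity (moment (nu_thetas 1%:pos thetas) (nbasis a j)); last first.
  by rewrite moment_nu_thetas_nbasis /= divr1.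
by rewrite /moment /Rintegral; congr fine; apply: eq_measure_integral => S mS _; exact: nuE.
Qed.

Unset Implicit Arguments.
Set Strict Implicit.
Set Printing Implicit Defensive.

Theorem proposition5p48 (R : realType) (q : nat) (theta : {posnum R})
    (nu : probability (borel_simplex R q) R) :
  [/\ (forall n : nat, (0 < n)%N ->
         pESF_measure theta%:num nu (multipartitions q.+1 n) = 1%E)
        <-> nu (vertices R q) = 1%E,
      nu (vertices R q) = 1%E ->
        exists thetas : 'I_q.+1 -> {nonneg R},
          [/\ exists j, (thetas j)%:num != 0,
              \sum_(j < q.+1) (thetas j)%:num = theta%:num
            & forall S : set (borel_simplex R q), measurable S ->
                nu S = nu_thetas theta thetas S]
    & forall thetas : 'I_q.+1 -> {nonneg R},
        (exists j, (thetas j)%:num != 0) ->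
        \sum_(j < q.+1) (thetas j)%:num = theta%:num ->
        forall n : nat, (0 < n)%N ->
        forall A : chromatic_partition q.+1 n,
          pESF theta%:num (nu_thetas theta thetas) A = ewens thetas A].
Proof.
split.
- split=> [mass1|nuV n _].
    apply: vertices_full; apply: (@vertex_moment1_of_mass2 _ _ theta%:num) => //.
      exact: vertex_moment0.
    exact: mass1.
  by apply: pESF_measure_multipartitions_eq1 => //; exact: vertex_moment_eq1.
- exact: vertices_decomposition.
- by move=> thetas _ sumT n _ A; exact: pESF_nu_thetas.
Qed.
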